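(* Let $G$ be a strongly topological gyrogroup with a symmetric neighborhood base $\mathscr U$ at $0$ and let $H$ be a second-countable admissible subgyrogroup of $G$ generated from $\mathscr U$. If the quotient space $G/H$ has a star-countable $cs$-network, then $G$ also has a star-countable $cs$-network.
   Context: All topological spaces are assumed to be Hausdorff. A gyrogroup is a set $G$ with a binary operation $\oplus$ such that: (G1) there is a unique identity element $0\in G$ with $0\oplus a=a=a\oplus 0$ for all $a\in G$; (G2) for each $x\in G$ there is a unique inverse $\ominus x\in G$ with $\ominus x\oplus x=0=x\oplus(\ominus x)$; (G3) for all $x,y\in G$ there is an automorphism $\mathrm{gyr}[x,y]$ of $(G,\oplus)$ with $x\oplus(y\oplus z)=(x\oplus y)\oplus \mathrm{gyr}[x,y](z)$ for all $z\in G$; (G4) $\mathrm{gyr}[x\oplus y,y]=\mathrm{gyr}[x,y]$ for all $x,y\in G$. A topological gyrogroup is a gyrogroup with a topology such that $\oplus:G\times G\to G$ is jointly continuous and $x\mapsto\ominus x$ is continuous. A strongly topological gyrogroup with a symmetric neighborhood base $\mathscr U$ at $0$ is a topological gyrogroup $G$ together with a neighborhood base $\mathscr U$ of $0$ such that for every $U\in\mathscr U$: $\ominus U=U$ and $\mathrm{gyr}[x,y](U)=U$ for all $x,y\in G$. A subgyrogroup of $G$ is a nonempty subset $H$ with $\ominus a\in H$ and $a\oplus b\in H$ for all $a,b\in H$; it is an $L$-subgyrogroup if moreover $\mathrm{gyr}[a,h](H)=H$ for all $a\in G$, $h\in H$. A subgyrogroup $H$ of $G$ is an admissible subgyrogroup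 generated from $\mathscr U$ if there is a sequence $\{U_n:n\in\omega\}$ of open symmetric neighborhoods of $0$ with each $U_n\in\mathscr U$, $U_{n+1}\oplus(U_{n+1}\oplus U_{n+1})\subset U_n$ for each $n\in\omega$, and $H=\bigcap_{n\in\omega}U_n$. Such an $H$ is known to be a closed $L$-subgyrogroup of $G$. For an $L$-subgyrogroup $H$, the set $G/H=\{a\oplus H:a\in G\}$ is a partition of $G$; it carries the quotient topology with respect to $\pi:G\to G/H$, $\pi(a)=a\oplus H$ (i.e. $O\subset G/H$ is open iff $\pi^{-1}(O)$ is open in $G$). Subsets such as $H$ carry the subspace topology. A family $\mathcal P$ of subsets of a space $X$ is a $cs$-network for $X$ if, given a sequence $\{x_n\}_n$ converging to a point $x$ in $X$ and a neighborhood $U$ of $x$ in $X$, there are $n_0\in\mathbb N$ and $P\in\mathcal P$ with $\{x\}\cup\{x_n:n\ge n_0\}\subset P\subset U$. A family $\mathcal P$ of sets is star-countable if each $P\in\mathcal P$ meets at most countably many members of $\mathcal P$. *)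

(* Defs.v *)
From HB Require Import structures.
From mathcomp Require Import all_boot generic_quotient.
From mathcomp Require Import all_classical.
From mathcomp Require Import topology.

Set Implicit Arguments.
Unset Strict Implicit.
Unset Printing Implicit Defensive.

Local Open Scope classical_set_scope.

Declare Scope gyro_scope.
Delimit Scope gyro_scope with gyro.

Definition gyro_automorphism {G : Type} (op : G -> G -> G) (f : G -> G) :=
  bijective f /\ {morph f : x y / op x y}.

HB.mixin Record isGyrogroup (G : Type) := {
  gzero : G;
  gadd : G -> G -> G;
  gopp : G -> G;
  gyr : G -> G -> G -> G;
  gadd0x : left_id gzero gadd;
  gaddx0 : right_id gzero gadd;
  gzero_unique : forall e : G, left_id e gadd -> right_id e gadd -> e = gzero;
  gaddNx : left_inverse gzero gopp gadd;
  gaddxN : right_inverse gzero gopp gadd;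
  gopp_unique : forall x y : G,
    gadd y x = gzero -> gadd x y = gzero -> y = gopp x;
  gyr_aut : forall x y : G, gyro_automorphism gadd (gyr x y);
  gyr_assoc : forall x y z : G,
    gadd x (gadd y z) = gadd (gadd x y) (gyr x y z);
  gyr_loop : forall x y : G, gyr (gadd x y) y = gyr x y
}.

#[short(type="gyrogroupType")]
HB.structure Definition Gyrogroup := {G of isGyrogroup G}.

Notation "x ⊕ y" := (gadd x y) (at level 50, left associativity) : gyro_scope.
Notation "⊖ x" := (gopp x) (at level 35, right associativity) : gyro_scope.

Local Open Scope gyro_scope.

HB.mixin Record Gyrogroup_isTopological G of Topological G & Gyrogroup G := {
  gadd_continuous : continuous (fun p : G * G => p.1 ⊕ p.2);
  gopp_continuous : continuous (fun x : G => ⊖ x)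
}.

#[short(type="topGyrogroupType")]
HB.structure Definition TopologicalGyrogroup :=
  {G of Topological G & Gyrogroup G & Gyrogroup_isTopological G}.

Definition gadd_set {G : gyrogroupType} (A B : set G) : set G :=
  [set a ⊕ b | a in A & b in B].

Definition gopp_set {G : gyrogroupType} (A : set G) : set G :=
  [set ⊖ a | a in A].

Definition left_coset {G : gyrogroupType} (a : G) (H : set G) : set G :=
  [set a ⊕ h | h in H].

Definition nbhs_base {T : topologicalType} (x : T) (B : set (set T)) :=
  (forall U, B U -> nbhs x U) /\
  (forall A, nbhs x A -> exists2 U, B U & U `<=` A).

Definition strongly_topological {G : topGyrogroupType} (B : set (set G)) :=
  nbhs_base (gzero : G) B /\
  forall U, B U ->
    gopp_set U = U /\ forall x y : G, gyr x y @` U = U.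

Definition subgyrogroup {G : gyrogroupType} (H : set G) :=
  [/\ H !=set0,
      forall a, H a -> H (⊖ a)
    & forall a b, H a -> H b -> H (a ⊕ b)].

Definition admissible_subgyrogroup {G : topGyrogroupType} (B : set (set G))
    (H : set G) :=
  subgyrogroup H /\
  exists U : nat -> set G,
    [/\ forall n, [/\ open (U n), U n gzero, gopp_set (U n) = U n & B (U n)],
        forall n, gadd_set (U n.+1) (gadd_set (U n.+1) (U n.+1)) `<=` U n
      & H = \bigcap_n U n].

(* The type of all subsets of the form a ⊕ H. It is formed for an arbitrary
   subset H; the cosets partition G when H is an L-subgyrogroup. *)
Definition cosets {G : gyrogroupType} (H : set G) : Type :=
  set_type (range (left_coset ^~ H)).

Section CosetQuotient.
Context {G : gyrogroupType} (H : set G).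

Definition coset_pi (a : G) : cosets H :=
  SigSub (mem_set (imageT (left_coset ^~ H) a)).

Definition coset_repr (C : cosets H) : G :=
  projT1 (cid2 (set_mem (valP C))).

Lemma coset_reprK : cancel coset_repr coset_pi.
Proof.
move=> C; apply: val_inj => /=; rewrite /coset_repr.
by case: cid2 => a _ /=.
Qed.

HB.instance Definition _ := isQuotient.Build G (cosets H) coset_reprK.
End CosetQuotient.

(* The coset space G/H with the final topology for a |-> a ⊕ H. *)
Definition coset_space {G : topGyrogroupType} (H : set G) : topologicalType :=
  quotient_topology (cosets H).

Definition cs_network {X : topologicalType} (P : set (set X)) :=
  forall (u : nat -> X) (x : X) (U : set X),
    u @ \oo --> x -> nbhs x U ->
    exists (n0 : nat) (A : set X),
      [/\ P A, [set x] `|` u @` [set n | n0 <= n] `<=` A & A `<=` U].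

Definition star_countable {X : Type} (P : set (set X)) :=
  forall A, P A -> countable [set B | P B /\ A `&` B !=set0].

(* Main.v *)
(* Let pi : G -> G/H, let P be the given network, E a countable dense subset of
   H and VV a countable family of members of the base at 0 such that the sets
   H ∩ (V ⊕ (V ⊕ V)) for V in VV are arbitrarily small. Pick a lift c C of a
   point of each nonempty C in P. The network of G consists of the sets
   pi^-1(A) ∩ ((c C ⊕ e) ⊕ V) with A, C in P meeting each other, e in E and V
   in VV. If two of them meet then so do their A's, and each A meets only
   countably many C's, so the family is star-countable. It is a cs-network
   because pi is open, the points c C ⊕ e are dense above the C's, and near x
   the topology of G is generated by pi together with the translates of VV. *)

Require Import Defs.
From mathcomp Require Import all_boot all_classical topology.
From mathcomp Require Import generic_quotient.

Local Open Scope classical_set_scope.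

(** * Gyrogroup identities, gyration-invariant sets and their cosets *)

Section Gyrogroup.
Local Open Scope gyro_scope.
Context {G : gyrogroupType}.
Implicit Types (x y z : G) (S T : set G).

Lemma gyr_inj {x y} : injective (gyr x y).
Proof. by case: (gyr_aut x y) => /bij_inj. Qed.

Lemma gadd_inj {x} : injective (gadd x).
Proof.
move=> y z e; apply: (@gyr_inj (⊖ x) x); rewrite -[LHS]gadd0x -[RHS]gadd0x.
by rewrite -(gaddNx x) -!gyr_assoc e.
Qed.

Lemma gyr0x x z : gyr gzero x z = z.
Proof. by apply: (@gadd_inj x); rewrite -{1}[x]gadd0x -gyr_assoc gadd0x. Qed.

(** The loop property turns [gyr (⊖ x) x] into [gyr gzero x], which is the identity. *)
Lemma gaddKx x y : ⊖ x ⊕ (x ⊕ y) = y.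
Proof. by rewrite gyr_assoc -gyr_loop gaddNx gyr0x gadd0x. Qed.

Lemma gaddxK x y : x ⊕ (⊖ x ⊕ y) = y.
Proof. by rewrite gyr_assoc -gyr_loop gaddxN gyr0x gadd0x. Qed.

Definition gyr_invariant S := forall x y, gyr x y @` S = S.

Lemma gyr_invariant_mem {S} x y {z} : gyr_invariant S -> S z -> S (gyr x y z).
Proof. by move=> iS Sz; rewrite -(iS x y); exists z. Qed.

Lemma gyr_invariant_preim {S} x y {z} : gyr_invariant S -> S z ->
  exists2 t, S t & z = gyr x y t.
Proof. by move=> iS; rewrite -{1}(iS x y) => -[t St <-]; exists t. Qed.

Lemma gyr_invariant_assoc {S} x y {z} : gyr_invariant S -> S z ->
  exists2 t, S t & x ⊕ y ⊕ z = x ⊕ (y ⊕ t).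
Proof.
move=> iS /(gyr_invariant_preim x y iS)[t St ->].
by exists t => //; rewrite gyr_assoc.
Qed.

Lemma gyr_invariant_bigcap {J : Type} (U : J -> set G) :
  (forall i, gyr_invariant (U i)) -> gyr_invariant (\bigcap_i U i).
Proof.
move=> iU x y; apply/seteqP; split=> [_ [z Uz <-] i _|z Uz].
  by apply: gyr_invariant_mem => //; exact: Uz.
case: (gyr_aut x y) => -[f fK gyrK] _.
(* The inverse [f] of the gyration gives a single preimage of [z] that serves for every [i]. *)
exists (f z); last exact: gyrK.
move=> i _; have [t Ut ->] := gyr_invariant_preim x y (iU i) (Uz i I).
by rewrite fK.
Qed.

(** The element equals [gyr x v (⊖ v)]. This lets centre and point be exchanged: [S (⊖ x ⊕ d)]
    implies [S (⊖ d ⊕ x)]. *)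
Lemma gyr_invariant_oppD {S} x v : gyr_invariant S ->
  (forall z, S z -> S (⊖ z)) -> S v -> S (⊖ (x ⊕ v) ⊕ x).
Proof.
move=> iS oS Sv.
have -> : ⊖ (x ⊕ v) ⊕ x = gyr x v (⊖ v).
  by apply: (@gadd_inj (x ⊕ v)); rewrite gaddxK -gyr_assoc gaddxN gaddx0.
apply: gyr_invariant_mem => //; exact: oS.
Qed.

Lemma subgyrogroup0 {H : set G} : subgyrogroup H -> H gzero.
Proof. by move=> [[h Hh] HN HD]; rewrite -(gaddxN h); exact/HD/HN. Qed.

Lemma coset_piP (H : set G) x y : subgyrogroup H -> gyr_invariant H ->
  coset_pi H x = coset_pi H y <-> exists2 h, H h & y = x ⊕ h.
Proof.
move=> sH iH; have [_ HN HD] := sH; split.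
  move=> /(congr1 val)/= e; suff [h Hh <-] : left_coset x H y by exists h.
  by rewrite e; exists gzero; [exact: subgyrogroup0|rewrite gaddx0].
move=> [h Hh ->].
apply: (@val_inj _ _ (set_type (range (left_coset ^~ H)))) => /=.
apply/seteqP; split => _ [k Hk <-].
  (* Obtained by re-associating [x ⊕ k = x ⊕ (h ⊕ (⊖ h ⊕ k))]. *)
  exists (gyr x h (⊖ h ⊕ k)).
    by apply: gyr_invariant_mem => //; exact/HD/Hk/HN.
  by rewrite -gyr_assoc gaddxK.
have [t Ht ->] := gyr_invariant_assoc x h iH Hk.
by exists (h ⊕ t) => //; exact: HD.
Qed.

End Gyrogroup.

(** * Countable dense sets and countable local bases *)

Section SecondCountable.
Context {T : topologicalType}.

Lemma countable_image {aT rT : Type} (f : aT -> rT) (A : set aT) :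
  countable A -> countable (f @` A).
Proof. exact/sub_countable/card_image_le. Qed.

Lemma second_countable_dense :
  @second_countable T -> exists2 E : set T, countable E & dense E.
Proof.
move=> [D cD [_ bD]].
have /choice[F FP] (C : set T) :
    exists F, countable F /\ (C !=set0 -> C `&` F !=set0).
  have [[x Cx]|C0] := pselect (C !=set0); last by exists set0.
  by exists [set x]; split; [exact: countable1|exists x].
exists (\bigcup_(C in D) F C).
  by apply: bigcup_countable => // C _; case: (FP C).
move=> O [x Ox] oO; have [C [DC Cx] CO] := bD x O (open_nbhs_nbhs (conj oO Ox)).
have [y [Cy Fy]] := (FP C).2 (ex_intro _ x Cx).
by exists y; split; [exact: CO|exists C].
Qed.

Lemma second_countable_nbhs_base (x : T) : @second_countable T ->
  exists2 C : set (set T), countable C & nbhs_base x C.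
Proof.
move=> [D cD [oD bD]]; exists [set U | D U /\ U x].
  by apply: sub_countable cD; apply: subset_card_le => U [].
split=> [U [DU Ux]|A /bD[U DUx UA]]; last by exists U.
by apply: open_nbhs_nbhs; split=> //; exact: oD.
Qed.

End SecondCountable.

(** * Translations, small neighborhoods of 0 and openness of the projection *)

Section TopologicalGyrogroup.
Local Open Scope gyro_scope.
Local Open Scope quotient_scope.
Context {G : topGyrogroupType}.
Implicit Types (x y z : G) (V W : set G).

Lemma gaddl_continuous x : continuous (gadd x).
Proof.
move=> y; apply: (@continuous2_cvg _ _ _ _ _ _ _ _ gadd).
- exact: (gadd_continuous (x, y)).
- exact: cvg_cst.
- exact: cvg_id.
Qed.

Lemma gaddr_continuous y : continuous (gadd ^~ y).
Proof.
move=> x; apply: (@continuous2_cvg _ _ _ _ _ _ _ _ gadd).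
- exact: (gadd_continuous (x, y)).
- exact: cvg_id.
- exact: cvg_cst.
Qed.

Lemma nbhs_translate x {V} :
  nbhs (gzero : G) V -> nbhs x [set y | V (⊖ x ⊕ y)].
Proof.
by move=> V0; apply: (gaddl_continuous (⊖ x) x); rewrite /= gaddNx.
Qed.

Lemma nbhs_gadd0 {x V} : nbhs x V -> nbhs (gzero : G) [set y | V (x ⊕ y)].
Proof. by move=> Vx; apply: (gaddl_continuous x gzero); rewrite /= gaddx0. Qed.

Lemma nbhs0_gadd_set {V} : nbhs (gzero : G) V ->
  exists2 W, nbhs (gzero : G) W & gadd_set W W `<=` V.
Proof.
move=> V0; have := @gadd_continuous G (gzero, gzero) V.
rewrite /= gaddx0 => /(_ V0) [[A C] /= [A0 C0]] AC.
exists (A `&` C); first exact: filterI.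
by move=> _ [a [Aa _]] [c [_ Cc] <-]; exact: (AC (a, c)).
Qed.

(** By continuity at 0, each member of a countable base at 0 in [H] contains the trace on [H] of
    some [V ⊕ (V ⊕ V)]; one such [V] is chosen per member. *)
Lemma second_countable_subset_nbhs0 (B : set (set G)) (H : set G) :
  nbhs_base (gzero : G) B -> H gzero -> @second_countable (set_type H) ->
  exists VV : set (set G), [/\ countable VV, VV `<=` B &
    forall W, nbhs (gzero : G) W ->
      exists2 V, VV V & H `&` gadd_set V (gadd_set V V) `<=` W].
Proof.
move=> [nB bB] H0 /second_countable_nbhs_base.
move=> /(_ (SigSub (mem_set H0)))[C cC [nC bC]].
have /choice[f fP] (D : set (set_type H)) : exists V, B V /\
    (C D -> forall x : set_type H,
      gadd_set V (gadd_set V V) (set_val x) -> D x).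
  have [/nC|nCD] := pselect (C D); last first.
    by have [V BV _] := bB _ (@filterT _ (nbhs (gzero : G)) _); exists V.
  rewrite nbhsE => -[O [[N oN NO] O0] OD].
  have : nbhs (gzero : G) N.
    by apply: open_nbhs_nbhs; split=> //; rewrite -NO in O0.
  move=> /nbhs0_gadd_set[N1 N10 N1N].
  have /nbhs0_gadd_set[N2 N20 N2N1] := N10.
  have [V BV VN] := bB _ (filterI N10 N20).
  exists V; split=> // _ x [a Va [_ [b Vb [c Vc <-]] xE]]; apply: OD.
  rewrite -NO /= -xE; apply: N1N; exists a; first exact: (VN _ Va).1.
  exists (b ⊕ c) => //; apply: N2N1; exists b; first exact: (VN _ Vb).2.
  by exists c => //; exact: (VN _ Vc).2.
exists (f @` C); split.
- exact: countable_image.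
- by move=> _ [D _ <-]; case: (fP D).
move=> W W0.
have /bC[D CD DW] : nbhs (SigSub (mem_set H0) : set_type H) (set_val @^-1` W).
  exact: (@initial_continuous (set_type H) G set_val).
exists (f D); first by exists D.
move=> x [Hx Vx]; apply: (DW (SigSub (mem_set Hx))).
by apply: (fP D).2 => //.
Qed.

Section CosetSpace.
Context {H : set G}.
Hypotheses (sH : subgyrogroup H) (iH : gyr_invariant H).

Lemma coset_space_piP x y :
  \pi_(coset_space H) x = \pi_(coset_space H) y <-> exists2 h, H h & y = x ⊕ h.
Proof.
by rewrite !unlock; exact: coset_piP.
Qed.

(* The preimage of the image of [V] is the union over [h] in [H] of the
   preimages of [V] by the right translations by [h]. *)
Lemma open_coset_space_image V : open V -> open (\pi_(coset_space H) @` V).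
Proof.
move=> oV; rewrite /open/= /quotient_open.
rewrite [X in open X](_ : _ = \bigcup_(h in H) (gadd ^~ h @^-1` V)).
  by apply: bigcup_open => h _; exact: open_comp (in1W (gaddr_continuous h)) oV.
apply/seteqP; split=> [x [y Vy] /esym/coset_space_piP[h Hh yxh]|x [h Hh Vxh]].
  by exists h => //=; rewrite -yxh.
by exists (x ⊕ h) => //; apply/esym/coset_space_piP; exists h.
Qed.

Lemma nbhs_coset_space_image {x V} :
  nbhs x V -> nbhs (\pi_(coset_space H) x) (\pi_(coset_space H) @` V).
Proof.
rewrite nbhsE => -[O [oO Ox] OV]; apply: (@filterS _ _ _ (_ @` O)).
  exact: image_subset.
by apply: open_nbhs_nbhs; split; [exact: open_coset_space_image|exists x].
Qed.

End CosetSpace.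
End TopologicalGyrogroup.

(** * Lifting the network from the coset space to the gyrogroup *)

Section Network.
Local Open Scope gyro_scope.
Local Open Scope quotient_scope.
Context {G : topGyrogroupType} {B : set (set G)} {H : set G}.
Hypotheses (hB : strongly_topological B) (sH : subgyrogroup H)
  (iH : gyr_invariant H).

Local Notation pi := (\pi_(coset_space H)).

Lemma base_gyr_invariant {V} : B V -> gyr_invariant V.
Proof. by case: hB => _ /[apply] -[]. Qed.

Lemma base_gopp {V x} : B V -> V x -> V (⊖ x).
Proof. by case: hB => _ /[apply] -[oV _] Vx; rewrite -oV; exists x. Qed.

(* Here [y = x ⊕ (a ⊕ v) = x ⊕ (w ⊕ h)] with [a], [v], [w] in [V] and [h] in
   [H], so [h = ⊖ w ⊕ (a ⊕ v)] is in [H] and in [V ⊕ (V ⊕ V)], hence in [W]. *)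
Lemma translate_cap_preimage_sub {x d y V W} : B V ->
  H `&` gadd_set V (gadd_set V V) `<=` W ->
  V (⊖ x ⊕ d) -> V (⊖ d ⊕ y) ->
  (pi @` [set z | (V `&` W) (⊖ x ⊕ z)]) (pi y) ->
  gadd_set W W (⊖ x ⊕ y).
Proof.
move=> BV VW Vd Vy [z [Vz Wz]] /(coset_space_piP sH iH)[h Hh yE].
have iV := base_gyr_invariant BV.
have [h' Hh' yE'] := gyr_invariant_assoc x (⊖ x ⊕ z) iH Hh.
have [v Vv yE''] := gyr_invariant_assoc x (⊖ x ⊕ d) iV Vy.
rewrite !gaddxK in yE' yE''.
rewrite yE yE' gaddKx; exists (⊖ x ⊕ z) => //; exists h' => //.
apply: VW; split=> //.
exists (⊖ (⊖ x ⊕ z)); first exact: base_gopp.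
exists ((⊖ x ⊕ d) ⊕ v); first by exists (⊖ x ⊕ d) => //; exists v.
have -> : (⊖ x ⊕ d) ⊕ v = (⊖ x ⊕ z) ⊕ h'.
  by apply: (@gadd_inj _ x); rewrite -yE' -yE -yE''.
by rewrite gaddKx.
Qed.

(** Up to a gyration, [⊖ d ⊕ y] is the sum of [⊖ d ⊕ x] and [⊖ x ⊕ y], so a gyration-invariant [V']
    with [V' ⊕ V'] inside [V] works uniformly in [x] and [d]. *)
Lemma nbhs_translate_sym {V} : nbhs (gzero : G) V ->
  exists2 V', nbhs (gzero : G) V' &
    forall x d, V' (⊖ x ⊕ d) -> nbhs x [set y | V (⊖ d ⊕ y)].
Proof.
move=> /nbhs0_gadd_set[W W0 WV].
have [[nB bB] _] := hB.
have [V' BV' V'W] := bB _ W0; have iV' := base_gyr_invariant BV'.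
exists V' => [|x d V'd]; first exact: nB.
apply: filterS (nbhs_translate x (nB _ BV')) => y /= V'y; apply: WV.
have V'q : V' (⊖ d ⊕ x).
  rewrite -{1}(gaddxK x d); apply: gyr_invariant_oppD => // z.
  exact: base_gopp.
exists (⊖ d ⊕ x); first exact: V'W.
have [t V't e] := gyr_invariant_assoc d (⊖ d ⊕ x) iV' V'y.
exists t; first exact: V'W.
by apply: (@gadd_inj _ d); rewrite -e !gaddxK.
Qed.

(** The fibre [d ⊕ H] meets [O], so the [k] in [H] with [d ⊕ k] in [O] form a nonempty open subset
    of [H]. *)
Lemma dense_coset (E : set (set_type H)) (O : set G) d : dense E -> open O ->
  (pi @` O) (pi d) -> exists2 e, E e & O (d ⊕ set_val e).
Proof.
move=> dE oO [y Oy /esym/(coset_space_piP sH iH)[h Hh yE]].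
have [||e [Oe Ee]] := dE [set k : set_type H | O (d ⊕ set_val k)].
- by exists (SigSub (mem_set Hh)); rewrite /= -yE.
- apply: (@open_comp (set_type H) G (fun k => d ⊕ set_val k)) oO => k _.
  apply: (@continuous_comp (set_type H) G G set_val).
    exact: initial_continuous.
  exact: gaddl_continuous.
- by exists e.
Qed.

Lemma lift_star_countable_cs_network (P : set (set (coset_space H))) :
  @second_countable (set_type H) -> star_countable P -> cs_network P ->
  exists Q : set (set G), star_countable Q /\ cs_network Q.
Proof.
move=> hH2 starP csP.
have [nbB _] := hB.
have [E cE dE] := second_countable_dense hH2.
have [VV [cVV VVB VVW]] :=
  second_countable_subset_nbhs0 _ _ nbB (subgyrogroup0 sH) hH2.
have /choice[c cP] (C : set (coset_space H)) :
    exists a : G, C !=set0 -> C (pi a).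
  have [[q Cq]|C0] := pselect (C !=set0); last by exists gzero.
  by exists (repr q); rewrite reprK.
pose M A C (e : set_type H) V := [set y : G |
  A (pi y) /\ V (⊖ (c C ⊕ set_val e) ⊕ y)].
exists [set S | exists A C e V,
  [/\ [/\ P A, P C & A `&` C !=set0], E e, VV V & S = M A C e V]]; split.
  move=> _ [A [C [e [V [[PA _ _] _ _ ->]]]]].
  apply: (@sub_countable _ _ _ (\bigcup_(A' in [set A' | P A' /\ A `&` A' !=set0])
    \bigcup_(C' in [set C' | P C' /\ A' `&` C' !=set0])
      [set M A' C' p.1 p.2 | p in E `*` VV])); last first.
    apply: bigcup_countable => [|A' [PA' _]]; first exact: starP.
    apply: bigcup_countable => [|C' _]; first exact: starP.
    exact/countable_image/countableX.
  apply: subset_card_le => _ [[A' [C' [e' [V' [[PA' PC' AC'] Ee' VV' ->]]]]]].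
  move=> [y [[Ay _] [A'y _]]].
  exists A'; first by split=> //; exists (pi y).
  by exists C' => //; exists (e', V').
move=> u x O ux Ox.
have [W W0 WO] := nbhs0_gadd_set (nbhs_gadd0 Ox).
have [V VVV VW] := VVW W W0; have BV := VVB _ VVV; have V0 := nbB.1 _ BV.
have [V' V'0 V'V] := nbhs_translate_sym V0.
have pix : continuous_at x pi by exact: pi_continuous.
have [n0 [A [PA Au AVW]]] := csP _ _ _ (cvg_comp u pi ux pix)
  (nbhs_coset_space_image sH iH (nbhs_translate x (filterI V0 W0))).
(* For a centre [d] in [N], [V'] makes [d ⊕ V] a neighborhood of [x], and [V] keeps [d] close enough
   to [x] for the final inclusion. *)
set N := [set y | (V `&` V') (⊖ x ⊕ y)].
have Nx : nbhs x N by exact/nbhs_translate/filterI.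
(* The constant sequence produces a [C] around [pi x] so small that its lift, moved by some [e] in
   [E], falls into [N]. *)
have cstx : (fun=> pi x) @ \oo --> pi x by exact: cvg_cst.
have [m [C [PC Cx CN]]] := csP _ _ _ cstx
  (nbhs_coset_space_image sH iH (nbhs_interior Nx)).
have {}Ax : A (pi x) by apply: Au; left.
have {}Cx : C (pi x) by apply: Cx; left.
have [e Ee /interior_subset[Vd V'd]] :=
  dense_coset _ _ _ dE (@open_interior _ _) (CN _ (cP _ (ex_intro _ _ Cx))).
have Vx := V'V _ _ V'd.
have [n1 _ Vu] := ux _ Vx.
exists (maxn n0 n1), (M A C e V); split.
- by exists A, C, e, V; split=> //; split=> //; exists (pi x).
- move=> y [->|[n /= + <-]]; first by split=> //; exact: nbhs_singleton Vx.
  rewrite geq_max => /andP[n0n n1n]; split; last exact: Vu.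
  by apply: Au; right; exists n.
- move=> y [Ay Vy]; rewrite -(gaddxK x y); apply: WO.
  exact: (translate_cap_preimage_sub BV VW Vd Vy (AVW _ Ay)).
Qed.

End Network.

Theorem theorem3p8 (G : topGyrogroupType) (B : set (set G)) (H : set G)
  (hG : hausdorff_space G)
  (hB : strongly_topological B)
  (hH : admissible_subgyrogroup B H)
  (hH2 : @second_countable (set_type H))
  (hQ : exists P : set (set (coset_space H)), star_countable P /\ cs_network P) :
  exists P : set (set G), star_countable P /\ cs_network P.
Proof.
have [sH [U [Uo _ HE]]] := hH; have [P [starP csP]] := hQ.
apply: (lift_star_countable_cs_network hB sH _ P) => //.
(* [H] inherits gyration invariance from the sets [U n], which are members of [B]. *)
rewrite HE; apply: gyr_invariant_bigcap => n.
by apply: (base_gyr_invariant hB); case: (Uo n).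
Qed.
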